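(* For each integer $a \ge 2$, the limit $$\Omega(a) = \lim_{N\to\infty} \frac{1}{N}\,\bigl|\{2 \le \beta \le N : a \text{ participates for } \beta\}\bigr|$$ exists and is of the form $\ell/(a^2-1)$ for some integer $1 \le \ell < a^2-1$ that depends on $a$. In particular, $0 < \Omega(a) < 1$.
   Context: A base-$\beta$ representation ($\beta \ge 2$) of a positive integer is canonical if it has no leading zero. A pair of positive integers $a \le b$ is a reversed sum-product pair for the base $\beta$ if the canonical base-$\beta$ representations of $a+b$ and $ab$ are the reverse of each other as digit strings (in particular they have the same number of digits). We say that $a$ participates for the base $\beta$ if there exists an integer $b > \beta$ such that $(a,b)$ is a reversed sum-product pair for the base $\beta$. *)

(* Defs.v *)
From HB Require Import structures.
From mathcomp Require Import all_boot all_order all_algebra.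
From mathcomp Require Import all_classical all_reals all_analysis.

Set Implicit Arguments.
Unset Strict Implicit.
Unset Printing Implicit Defensive.

Import Order.TTheory GRing.Theory Num.Theory.
Import numFieldNormedType.Exports.

Local Open Scope nat_scope.

(* Digit strings are written most significant digit first. *)
Definition digits_val (beta : nat) (s : seq nat) : nat :=
  foldl (fun acc d => acc * beta + d) 0 s.

(* The default 0 in [head] also rules out the empty string, which would
   otherwise represent 0; only positive integers are represented. *)
Definition canonical_rep (beta n : nat) (s : seq nat) : Prop :=
  [/\ all (fun d => d < beta) s, head 0 s != 0 & digits_val beta s = n].

Definition reversed_sum_product_pair (beta a b : nat) : Prop :=
  0 < a <= b /\
  exists s : seq nat,
    canonical_rep beta (a + b) s /\ canonical_rep beta (a * b) (rev s).

Definition participates (a beta : nat) : Prop :=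
  exists b : nat, beta < b /\ reversed_sum_product_pair beta a b.

Definition participating_bases (a N : nat) : {set 'I_N.+1} :=
  [set beta : 'I_N.+1 | (2 <= beta) && `[< participates a beta >] ].

(* The term at N = 0 is 0 / 0 = 0. *)
Definition participation_ratio (R : realType) (a N : nat) : R :=
  (#|participating_bases a N|%:R / N%:R)%R.

(* [limn] is total; it is the actual limit when the sequence converges. *)
Definition Omega (R : realType) (a : nat) : R :=
  limn (participation_ratio R a).

(* Main.v *)
(* With m = a + b, the pair condition says that a m - a^2 is the digit reversal
   of m. For beta > a^2 + 1 all carries t_i in this computation lie in [0, a).
   Replacing beta by beta + q (a^2 - 1), each digit c_i by
   c_i + q (a t_(i+1) + t_(k-i)) and keeping the carries gives a solution in the
   larger base. Hence, for large beta, participation depends only on beta modulo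
   a^2 - 1. The class of 3 a^2 + a - 4 participates (two-digit solution
   4 | 4a+1), while the class of 0 does not: there, the equations for the
   outermost digits force t_(k-1) = a modulo a^2 - 1. *)
Require Import Defs.
From mathcomp Require Import all_boot all_order all_algebra.
From mathcomp Require Import all_classical all_reals all_analysis.
From mathcomp Require Import zify ring lra.

Import Order.TTheory GRing.Theory Num.Theory.
Import numFieldNormedType.Exports.

Local Open Scope nat_scope.

(** * Positional values, least significant digit first *)

(** Digits form a function rather than a list, so that reversal is the reindexing [i] to
    [k.-1 - i]. *)
Definition little_val (beta : nat) (c : nat -> nat) (k : nat) : nat :=
  \sum_(i < k) c i * beta ^ i.

Lemma little_valS beta c k :
  little_val beta c k.+1 = little_val beta c k + c k * beta ^ k.
Proof. by rewrite /little_val big_ord_recr. Qed.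

Lemma little_valSl beta c k :
  little_val beta c k.+1 = c 0 + beta * little_val beta (fun i => c i.+1) k.
Proof.
rewrite /little_val big_ord_recl expn0 muln1; congr (_ + _).
rewrite big_distrr /=; apply: eq_bigr => i _.
by rewrite /bump /= add1n expnS mulnCA.
Qed.

Lemma little_val_split beta c i j :
  little_val beta c (i + j)
  = little_val beta c i + beta ^ i * little_val beta (fun n => c (i + n)) j.
Proof.
elim: j => [|j IHj]; first by rewrite addn0 /little_val big_ord0 muln0 addn0.
by rewrite addnS !little_valS IHj expnD; ring.
Qed.

Lemma little_val_lt beta c k :
  0 < beta -> (forall i, i < k -> c i < beta) -> little_val beta c k < beta ^ k.
Proof.
move=> beta_gt0; elim: k => [|k IHk] c_lt; first by rewrite /little_val big_ord0.
rewrite little_valS expnS.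
have lt_k := IHk (fun i lt_ik => c_lt i (ltnW lt_ik)).
have := leq_mul (c_lt k (ltnSn k)) (leqnn (beta ^ k)); rewrite mulSn.
by apply: leq_trans; rewrite ltn_add2r.
Qed.

Lemma eq_little_val beta c d k :
  (forall i, i < k -> c i = d i) -> little_val beta c k = little_val beta d k.
Proof. by move=> eq_cd; apply: eq_bigr => i _; rewrite eq_cd. Qed.

Lemma digits_val_rev beta s :
  digits_val beta (rev s) = little_val beta (nth 0 s) (size s).
Proof.
elim: s => [|x s IHs]; first by rewrite /little_val big_ord0.
rewrite rev_cons -cats1 /digits_val foldl_cat /= -/(digits_val beta (rev s)).
by rewrite IHs little_valSl addnC mulnC.
Qed.

(* [carries a beta k c t]: in base beta, the k-digit number with digits c
   (least significant first), multiplied by a and diminished by a ^ 2, is its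
   own reversal, and t i is the carry into position i. *)
Definition carries (a beta k : nat) (c t : nat -> nat) : Prop :=
  [/\ forall i, i < k -> c i < beta, c k.-1 != 0, forall i, t i < a,
      t 0 = 0 /\ t k = 0
    & forall i, i < k ->
        a * c i + t i = c (k.-1 - i) + beta * t i.+1 + (i == 0) * a ^ 2].

(** The bound [1 < k] is the counterpart of [beta < b]. *)
Definition reversal_solvable (a beta : nat) : Prop :=
  exists k c t, 1 < k /\ carries a beta k c t.

(** * Shifting the base by multiples of [a ^ 2 - 1] *)

(** With [e i = a * t i.+1 + t (k - i)], one has [a * e i = e (k.-1 - i) + (a ^ 2 - 1) * t i.+1],
    which matches the growth of [beta * t i.+1]. *)
Lemma carries_shift a beta q k c t :
  0 < a -> carries a beta k c t ->
  carries a (beta + q * (a ^ 2 - 1)) k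
    (fun i => c i + q * (a * t i.+1 + t (k - i))) t.
Proof.
move=> a_gt0 [c_lt ck t_lt t0k ct]; split=> //.
- move=> i lt_ik; have := c_lt _ lt_ik.
  (* Both carries are at most [a - 1] and [(a + 1) * (a - 1) = a ^ 2 - 1], so no digit grows by more
     than the base. *)
  have : a * t i.+1 + t (k - i) <= a ^ 2 - 1.
    have := t_lt i.+1; have := t_lt (k - i); nia.
  by move/(leq_mul (leqnn q)); lia.
- by rewrite addn_eq0 negb_and ck.
- move=> i lt_ik; have E := ct _ lt_ik.
  have -> : k - (k.-1 - i) = i.+1 by lia.
  have -> : (k.-1 - i).+1 = k - i by lia.
  have -> : a ^ 2 - 1 = a.-1 * a.+1 by case: (a) a_gt0 => // n _; lia.
  move: E; case: (a) a_gt0 => // n _ /= E.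
  nia.
Qed.

Lemma reversal_solvable_shift a beta q :
  0 < a -> reversal_solvable a beta ->
  reversal_solvable a (beta + q * (a ^ 2 - 1)).
Proof.
move=> a_gt0 [k [c [t [k_gt1 H]]]].
by exists k; eexists; exists t; split=> //; apply: carries_shift H.
Qed.

(** * Participation and carry systems *)

(** Weighting the digit equations by [beta ^ j] and summing cancels the inner carries. The term
    [a ^ 2] enters at position 0, hence [0 < i]. *)
Lemma carries_telescope a beta k c t i :
  carries a beta k c t -> 0 < i <= k ->
  a * little_val beta c i
  = a ^ 2 + little_val beta (fun j => c (k.-1 - j)) i + t i * beta ^ i.
Proof.
move=> [_ _ _ [t0 _] ct]; elim: i => // i IHi /= lt_ik.
rewrite !little_valS; have := ct _ lt_ik; case: i IHi lt_ik => [|i] IHi lt_ik.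
  by rewrite /little_val !big_ord0 t0 expn0 expn1; lia.
have {}IHi := IHi (ltnW lt_ik).
rewrite mulnDr IHi [beta ^ i.+2]expnS.
set p := beta ^ i.+1 => E; have : (a * c i.+1 + t i.+1) * p
  = (c (k.-1 - i.+1) + beta * t i.+2) * p by rewrite E mul0n addn0.
lia.
Qed.

Lemma carries_first_gt a beta k c t :
  0 < k -> carries a beta k c t -> a < c 0.
Proof.
move=> k_gt0 [_ ck _ [t0 _] ct]; have := ct 0 k_gt0.
rewrite t0 subn0 mul1n; move: ck; rewrite -lt0n; nia.
Qed.

Lemma reversal_solvable_participates a beta :
  0 < a -> reversal_solvable a beta -> participates a beta.
Proof.
move=> a_gt0 [k [c [t [k_gt1 H]]]].
have c0_gt := carries_first_gt _ _ _ _ _ (ltnW k_gt1) H.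
have tele := carries_telescope _ _ _ _ _ k H; rewrite leqnn andbT in tele.
have {}tele := tele (ltnW k_gt1).
case: H => c_lt ck _ [_ tk] _; rewrite {}tk mul0n addn0 in tele.
have lt_abeta : a < beta by have := c_lt 0 (ltnW k_gt1); lia.
(* For [b = m - a] this is [beta < b]: the last digit exceeds [a], and the nonzero leading digit
   contributes at least [beta]. *)
have m_gt : a + beta < little_val beta c k.
  case: k k_gt1 c_lt ck tele => [|[|k]] //= _ _ ck _.
  rewrite little_valS little_valSl.
  have : beta <= c k.+1 * beta ^ k.+1.
    by rewrite -[X in X <= _]mul1n leq_mul ?lt0n // expnS leq_pmulr // expn_gt0; lia.
  lia.
exists (little_val beta c k - a); split; first lia.
split; first by rewrite a_gt0 /=; lia.
exists (mkseq (fun i => c (k.-1 - i)) k).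
have revE : rev (mkseq (fun i => c (k.-1 - i)) k) = mkseq c k.
  apply: (@eq_from_nth _ 0); rewrite size_rev !size_mkseq // => i lt_ik.
  by rewrite nth_rev size_mkseq // !nth_mkseq //; [congr c|]; lia.
split; split.
- by apply/allP => x /mapP[i]; rewrite mem_iota => lt_ik ->; apply: c_lt; lia.
- by rewrite -nth0 nth_mkseq ?subn0 //; lia.
- rewrite -[mkseq _ k]revK revE digits_val_rev size_mkseq subnKC; last lia.
  by apply: eq_little_val => i lt_ik; rewrite nth_mkseq.
- rewrite revE; apply/allP => x /mapP[i].
  by rewrite mem_iota => lt_ik ->; apply: c_lt; lia.
- by rewrite revE -nth0 nth_mkseq; lia.
- rewrite digits_val_rev size_mkseq mulnBr tele.
  rewrite (eq_little_val _ _ (fun j => c (k.-1 - j))); first by rewrite mulnn; lia.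
  by move=> i lt_ik; rewrite nth_mkseq.
Qed.

(** Cut the identity [a * m = a ^ 2 + rev m] at position [i]: the imbalance of the lower parts is a
    multiple of [beta ^ i], and the quotient is the carry. The bound on [beta] forces the last digit
    to be at least [a], which keeps the quotient nonnegative. *)
Lemma participates_reversal_solvable a beta :
  0 < a -> a ^ 2 + 1 < beta -> participates a beta ->
  reversal_solvable a beta.
Proof.
move=> a_gt0 beta_gt [b [b_gt [_ [s [[s_lt s0 sE] [_ s0' rE]]]]]].
pose k := size s; pose d := nth 0 s; pose c := fun i => d (k.-1 - i).
have d_lt i : i < k -> d i < beta by move=> ?; apply: (allP s_lt); apply: mem_nth.
have c_lt i : i < k -> c i < beta by move=> ?; apply: d_lt; lia.
have mE : little_val beta c k = a + b.
  rewrite -sE -[X in digits_val _ X]revK digits_val_rev size_rev.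
  by apply: eq_little_val => i lt_ik; rewrite nth_rev // /c /d /k; congr nth; lia.
have {}rE : little_val beta d k = a * b by rewrite -rE digits_val_rev.
have k_gt1 : 1 < k.
  rewrite ltnNge; apply/negP => k_le1.
  have := little_val_lt beta c k ltac:(lia) c_lt; rewrite mE.
  by have := @leq_pexp2l beta k 1 ltac:(lia) k_le1; rewrite expn1; lia.
have ck : c k.-1 != 0 by rewrite /c subnn /d nth0.
have main : a * little_val beta c k = a ^ 2 + little_val beta d k.
  by rewrite mE rE mulnDr mulnn.
have beta_gt0 : 0 < beta by lia.
have split_at i e : i <= k -> little_val beta e k
   = little_val beta e i + beta ^ i * little_val beta (fun n => e (i + n)) (k - i).
  by move=> le_ik; rewrite -little_val_split subnKC.
(* If the last digit were below a, then a m < (a + 1) beta^(k-1), so the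
   leading digit would be 1; reducing modulo beta then gives a contradiction. *)
have c0_ge : a <= c 0.
  rewrite leqNgt; apply/negP => c0_lt.
  have dk : d k.-1 = c 0 by rewrite /c subn0.
  have d0 : d 0 = c k.-1 by rewrite /c subnn.
  have pk : a < beta ^ k.-1.
    have := @leq_pexp2l beta 1 k.-1 beta_gt0 ltac:(lia); rewrite expn1; nia.
  have kE : k = k.-1.+1 by lia.
  have d0_1 : d 0 = 1.
    move: main; rewrite kE !little_valS dk.
    have := little_val_lt beta d k.-1 beta_gt0 (fun i H => d_lt i ltac:(lia)).
    rewrite -[c k.-1]d0; move: (ck); rewrite -d0 -lt0n.
    move: (little_val _ _ _) (little_val _ _ _) (beta ^ k.-1) pk => A B p pk.
    move=> d0_gt0 B_lt main.
    have : d 0 < 2; last by lia.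
    rewrite ltnNge; apply/negP => d0_ge2.
    have le1 := leq_mul d0_ge2 (leqnn p).
    have le2 : a * (2 * p) <= a * (A + d 0 * p).
      by rewrite leq_mul2l (leq_trans le1) ?leq_addl ?orbT.
    have le3 := leq_mul c0_lt (leqnn p).
    have le4 : a * a < a * p by rewrite ltn_mul2l a_gt0.
    lia.
  move: main; rewrite kE !little_valSl d0_1.
  move: (little_val _ _ _) (little_val _ _ _) => B A main.
  have le1 : a * c 0 <= a * a by rewrite leq_mul2l ltnW ?orbT.
  case: (leqP (a * A) B) => [/(leq_mul (leqnn beta))|/(leq_mul (leqnn beta))].
    have : a * c 0 < a * a by rewrite ltn_mul2l a_gt0.
    lia.
  lia.
(* With [C] and [D] the lower parts, [a ^ 2 <= a * C < a * beta ^ i] and [D < beta ^ i] place the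
   quotient in [[0, a)]. *)
have carry i : 0 < i <= k -> exists2 t, t < a
    & a * little_val beta c i = a ^ 2 + little_val beta d i + t * beta ^ i.
  move=> /andP[i_gt0 le_ik]; move: main; rewrite !(split_at i) //.
  have Ld := little_val_lt beta d i beta_gt0 (fun j H => d_lt j ltac:(lia)).
  have Lc := little_val_lt beta c i beta_gt0 (fun j H => c_lt j ltac:(lia)).
  have : a <= little_val beta c i.
    by case: i i_gt0 {le_ik Ld Lc} => // i _; rewrite little_valSl; lia.
  move: (little_val beta c i) (little_val beta d i) Ld Lc => C D D_lt C_lt.
  move: (beta ^ i) D_lt C_lt => p D_lt C_lt C_ge.
  move: (little_val _ _ _) (little_val _ _ _) => H G E.
  have aC_ge : a * a <= a * C by rewrite leq_mul2l C_ge orbT.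
  have le1 : a * G <= H.
    by rewrite leqNgt; apply/negP => /(leq_mul (leqnn p)); lia.
  move: le1 E => /subnKC <-; move: (H - a * G) => u E.
  have {}E : a * C = a ^ 2 + D + u * p by lia.
  exists u => //; rewrite ltnNge; apply/negP => /leq_mul /(_ (leqnn p)).
  have : a * C < a * p by rewrite ltn_mul2l a_gt0.
  lia.
pose t i := if i == 0 then 0 else
  (a * little_val beta c i - (a ^ 2 + little_val beta d i)) %/ beta ^ i.
have tE i : 0 < i <= k -> t i < a /\
    a * little_val beta c i = a ^ 2 + little_val beta d i + t i * beta ^ i.
  move=> le_ik; have [u u_lt uE] := carry i le_ik.
  have -> : t i = u; last by [].
  rewrite /t; have -> : (i == 0) = false by lia.
  by rewrite uE addKn mulnK // expn_gt0 beta_gt0.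
have t0 : t 0 = 0 by [].
(* [carries] bounds [t] at every index, while [tE] covers only positions up to [k]; beyond them the
   carry is set to 0. *)
clearbody t; exists k, c, (fun i => if i <= k then t i else 0); split=> //; split=> //.
- move=> i; case: ifP => // le_ik; case: i le_ik => [|i] le_ik; first by rewrite t0.
  by have [] := tE i.+1 le_ik.
- split=> //; rewrite leqnn; have [_] := tE k ltac:(lia).
  rewrite main => /eqP; rewrite -[X in X == _]addn0 eqn_add2l eq_sym muln_eq0.
  by rewrite expn_eq0; lia.
- move=> i lt_ik; rewrite lt_ik (ltnW lt_ik).
  have -> : c (k.-1 - i) = d i by rewrite /c; congr d; lia.
  have [_] := tE i.+1 lt_ik; rewrite !little_valS.
  case: i lt_ik => [|i] lt_ik; first by rewrite /little_val !big_ord0 t0 expn0 expn1; lia.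
  (* The difference of two consecutive balances, divided by the power of [beta], is the digit
     equation. *)
  have [_] := tE i.+1 ltac:(lia); rewrite [beta ^ i.+2]expnS.
  have : 0 < beta ^ i.+1 by rewrite expn_gt0 beta_gt0.
  move: (beta ^ i.+1) => p p_gt0 E1 E2; apply/eqP.
  rewrite -(eqn_pmul2r p_gt0); lia.
Qed.

(** * One excluded and one solvable residue class *)

Lemma reversal_solvable_not_dvd a beta :
  1 < a -> reversal_solvable a beta -> ~~ (a ^ 2 - 1 %| beta).
Proof.
move=> a_gt1 [k [c [t [k_gt1 [_ _ t_lt [t0 tk] ct]]]]].
apply/negP => /dvdnP[u betaE].
have := ct 0 ltac:(lia); have := ct k.-1 ltac:(lia); rewrite subnn subn0.
have -> : (k.-1 == 0) = false by lia.
have -> : k.-1.+1 = k by lia.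
rewrite tk t0 eqxx mul0n mul1n muln0 !addn0 => E1 E2.
have := t_lt k.-1; move: E1 E2; rewrite betaE.
move: (c 0) (c k.-1) (t k.-1) (t 1) => y x r r'.
have [M aaE] : exists M, a ^ 2 = M.+1 by exists (a ^ 2).-1; nia.
have -> : a ^ 2 - 1 = M by rewrite aaE subn1.
rewrite aaE => E1 E2 r_lt.
(* Eliminate [y = a * x + r] from the two outer equations, multiply by [a] and use [a ^ 2 = M + 1].
   Then [M] divides [a - r], impossible as [0 < a - r <= a < M]. *)
have E : a - r + M * (a * u * r' + a) = M * (a * x + r) by nia.
have dvd : M %| a - r.
  by rewrite -(dvdn_addl _ (dvdn_mulr (a * u * r' + a) (dvdnn M))) E dvdn_mulr.
have := dvdn_leq (_ : 0 < a - r) dvd; have := leq_mul a_gt1 (leqnn a); lia.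
Qed.

(** For two digits and middle carry 1, a leading digit [x] gives last digit [a * x + 1] and base
    [(a ^ 2 - 1) * x + a - a ^ 2]. The value 4 is the least [x] that keeps the last digit below the
    base for every [a >= 2]. *)
Lemma reversal_solvable_exists a :
  1 < a -> reversal_solvable a (3 * a ^ 2 + a - 4).
Proof.
move=> a_gt1.
exists 2, (fun i => if i == 0 then 4 * a + 1 else 4), (fun i => (i == 1) : nat).
split=> //; split=> //.
- by move=> i _; case: ifP => _; nia.
- by move=> i; case: (i == 1); lia.
- by move=> [|[|i]] //= _; nia.
Qed.

(** * Densities of eventually periodic sets *)

Lemma sum_residues (S : pred nat) M n :
  \sum_(i < n * M) S (i %% M) = n * \sum_(i < M) S i.
Proof.
elim: n => [|n IHn]; first by rewrite big_ord0.
rewrite mulSnr big_split_ord /= IHn mulSnr; congr (_ + _).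
by apply: eq_bigr => i _; rewrite modnMDl modn_small.
Qed.

Lemma sum_residues_bounds (S : pred nat) M N : 0 < M ->
  N %/ M * \sum_(i < M) S i <= \sum_(i < N) S (i %% M)
    <= (N %/ M).+1 * \sum_(i < M) S i.
Proof.
move=> M_gt0.
have mono m n : m <= n -> \sum_(i < m) S (i %% M) <= \sum_(i < n) S (i %% M).
  by move/subnKC <-; rewrite big_split_ord leq_addr.
rewrite -!sum_residues !mono //; first exact: ltnW (ltn_ceil _ _).
exact: leq_trunc_div.
Qed.

(** The hypothesis is symmetric in [P] and [Q], so swapping them yields the other inequality. *)
Lemma sum_eventually_eq (P Q : pred nat) N0 N :
  (forall n, N0 <= n -> P n = Q n) ->
  \sum_(i < N) P i <= N0 + \sum_(i < N) Q i.
Proof.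
move=> PQ; elim: N => [|N IHN]; first by rewrite big_ord0.
rewrite !big_ord_recr /=; case: (leqP N0 N) => [/PQ ->|lt_N].
  by rewrite addnA leq_add2r.
have le_N : \sum_(i < N) P i <= N.
  by rewrite -[X in _ <= X]card_ord -sum1_card; apply: leq_sum => i _; case: (P i).
apply: leq_trans (leq_addr _ _); apply: leq_trans lt_N; rewrite -[N.+1]addn1.
by rewrite leq_add // leq_b1.
Qed.

Lemma cvg_ratio_of_bounded (R : realType) (u : nat -> nat) (l M C : nat) :
  0 < M -> (forall N, M * u N <= l * N + C /\ l * N <= M * u N + C) ->
  ((fun N => (u N)%:R / N%:R : R) @ \oo --> (l%:R / M%:R : R))%R%classic.
Proof.
move=> M_gt0 bound; apply/cvgrPdist_le => /= e e_gt0.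
near=> N.
have MR : (0 < M%:R :> R)%R by rewrite ltr0n.
have NR : (0 < N%:R :> R)%R by rewrite ltr0n; near: N; exact: nbhs_infty_gt.
(* The distance to the limit is at most [C / (M * N)], which is at most [e] from this threshold
   on. *)
have Ne : (C%:R / (M%:R * e) <= N%:R)%R by near: N; exact: nbhs_infty_ger.
have [b1 b2] := bound N.
rewrite -(ler_nat R) natrD !natrM in b1; rewrite -(ler_nat R) natrD !natrM in b2.
rewrite ler_pdivrMr ?mulr_gt0 // in Ne.
have -> : (l%:R / M%:R - (u N)%:R / N%:R
  = (l%:R * N%:R - M%:R * (u N)%:R) / (M%:R * N%:R) :> R)%R.
  by field; rewrite !gt_eqF.
rewrite normrM normfV (gtr0_norm (mulr_gt0 MR NR)) ler_pdivrMr ?mulr_gt0 //.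
by rewrite ler_norml; apply/andP; split; lra.
Unshelve. all: by end_near. Qed.

Lemma cvg_density (R : realType) (P S : pred nat) (M N0 : nat) :
  0 < M -> (forall n, N0 <= n -> P n = S (n %% M)) ->
  ((fun N => (\sum_(i < N.+1) P i)%:R / N%:R : R) @ \oo
     --> ((\sum_(i < M) S i)%:R / M%:R : R))%R%classic.
Proof.
move=> M_gt0 PS; set l := \sum_(i < M) S i.
(* [M * N0] covers the indices below [N0], [l * M] the incomplete last period, and [l] the shift
   from [N] to [N.+1] terms. *)
apply: (@cvg_ratio_of_bounded _ _ _ _ (M * N0 + l * M + l)) => // N.
have /andP[lo hi] := sum_residues_bounds S M N.+1 M_gt0.
have := sum_eventually_eq P (fun i => S (i %% M)) N0 N.+1 PS.
have := sum_eventually_eq (fun i => S (i %% M)) P N0 N.+1 (fun n h => esym (PS n h)).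
have := divn_eq N.+1 M; have := ltn_pmod N.+1 M_gt0.
move: (\sum_(i < N.+1) P i) (\sum_(i < N.+1) S _) (N.+1 %/ M) (N.+1 %% M) lo hi.
rewrite -/l => A B q r lo hi r_lt E B_le A_le.
have [El Em] : l * N + l = q * l * M + r * l /\ r * l <= M * l.
  by split; [rewrite -mulnSr E; ring | rewrite leq_mul2r ltnW ?orbT].
have := leq_mul (leqnn M) lo; have := leq_mul (leqnn M) hi.
have := leq_mul (leqnn M) A_le; have := leq_mul (leqnn M) B_le.
nia.
Qed.

(** Choose one element of [Q] in each residue class that meets [Q]; past the largest choice, each
    such class lies entirely in [Q]. *)
Lemma eventually_residue (Q : nat -> Prop) M : 0 < M ->
  (forall n q, Q n -> Q (n + q * M)) ->
  exists N0, forall n, N0 <= n ->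
    `[< Q n >] = `[< exists2 m, Q m & m %% M = n %% M >].
Proof.
move=> M_gt0 Qshift.
have /choice[f fP] (r : 'I_M) : exists m,
    (exists2 m, Q m & m %% M = r) -> Q m /\ m %% M = r.
  case: (pselect (exists2 m, Q m & m %% M = r)) => [[m Qm mr]|no].
    by exists m.
  (* A class that misses [Q] gets the dummy value 0. *)
  by exists 0.
exists (\max_r f r) => n ge_n; apply/idP/idP => /asboolP Qn; apply/asboolP.
  by exists n.
pose r := Ordinal (ltn_pmod n M_gt0).
have [Qf fr] := fP r Qn.
have le_f : f r <= n by apply: leq_trans ge_n; apply: (leq_bigmax r).
have -> : n = f r + (n %/ M - f r %/ M) * M; last exact: Qshift.
have := divn_eq n M; have := divn_eq (f r) M; rewrite fr /=.
have := leq_mul (leq_div2r M le_f) (leqnn M); rewrite mulnBl; lia.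
Qed.

(** * The density of participating bases *)

Lemma card_participating_bases a N :
  #|participating_bases a N|
  = \sum_(i < N.+1) ((2 <= i) && `[< participates a i >]).
Proof.
rewrite -sum1_card big_mkcond /=; apply: eq_bigr => i _.
by rewrite inE; case: (_ && _).
Qed.

Local Open Scope ring_scope.

Theorem corollary6p5 (R : realType) (a : nat) (ha : (2 <= a)%N) :
  [/\ cvgn (participation_ratio R a),
      exists l : nat,
        (1 <= l < a ^ 2 - 1)%N /\ Omega R a = l%:R / (a%:R ^+ 2 - 1)
    & 0 < Omega R a < 1].
Proof.
set M := (a ^ 2 - 1)%N; have M_gt0 : (0 < M)%N by rewrite /M; nia.
pose S r := `[< exists2 m, reversal_solvable a m & (m %% M)%N = r >].
have [N0 N0P] := @eventually_residue (reversal_solvable a) M M_gt0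
  (fun n q => @reversal_solvable_shift a n q (ltnW ha)).
(* The threshold [a ^ 2 + 2] is the bound [a ^ 2 + 1 < n] under which participation and solvability
   agree. *)
have PS n : (maxn N0 (a ^ 2 + 2) <= n)%N ->
    (2 <= n)%N && `[< participates a n >] = S (n %% M)%N.
  rewrite geq_max => /andP[/N0P N0n n_ge]; rewrite /S -N0n.
  have -> /= : (2 <= n)%N by lia.
  by apply/asboolP/asboolP;
    [apply: participates_reversal_solvable | apply: reversal_solvable_participates]; lia.
pose l := (\sum_(i < M) S i)%N.
have cvg_ratio : (participation_ratio R a @ \oo --> (l%:R / M%:R : R))%classic.
  have := @cvg_density R _ _ _ _ M_gt0 PS; apply: cvg_trans; apply: near_eq_cvg.
  by near=> N; rewrite /participation_ratio card_participating_bases.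
have OmegaE : Omega R a = l%:R / M%:R by apply: cvg_lim.
have l_gt0 : (0 < l)%N.
  have lt_r := ltn_pmod (3 * a ^ 2 + a - 4) M_gt0.
  rewrite /l (bigD1 (Ordinal lt_r)) //=.
  suff -> : S ((3 * a ^ 2 + a - 4) %% M)%N by [].
  by apply/asboolP; exists (3 * a ^ 2 + a - 4)%N => //; apply: reversal_solvable_exists.
(* Residue 0 contributes nothing, which leaves at most [M - 1] classes. *)
have l_lt : (l < M)%N.
  rewrite /l (bigD1 (Ordinal M_gt0)) //=.
  have -> : S 0%N = false.
    apply/asboolP => -[m /(@reversal_solvable_not_dvd _ _ ha) /negP H m0].
    by apply: H; rewrite /dvdn -/M m0.
  rewrite add0n; apply: (@leq_ltn_trans (\sum_(i < M | i != Ordinal M_gt0) 1)).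
    by apply: leq_sum => i _; case: (S i).
  by rewrite sum1_card cardC1 card_ord; lia.
have ME : M%:R = a%:R ^+ 2 - 1 :> R.
  by rewrite /M natrB ?natrX // expn_gt0; lia.
split.
- by apply/cvg_ex; exists (l%:R / M%:R).
- by exists l; rewrite l_gt0 l_lt OmegaE ME.
- by rewrite OmegaE divr_gt0 ?ltr0n //= ltr_pdivrMr ?ltr0n // mul1r ltr_nat.
Unshelve. all: by end_near. Qed.
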